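(* The sets $W(r,t,i)$, where $(t,i)\in D=\Lambda\times\{1,-1\}$, $r\in\Lambda\cup\{0\}$ and $r\prec t$, form a basis for a locally compact, scattered, Hausdorff topology on $D$.
   Context: A topological space is scattered if every non-empty open subset (equivalently, every non-empty subset) has a relatively isolated point. The tree $\Lambda$: $\Lambda$ is the set of all injective functions $t:\alpha\to\omega$, where $\alpha$ is a countable ordinal and $\omega\setminus\operatorname{ran} t$ is infinite; $s\preccurlyeq t$ means that $t$ extends $s$. Write $\operatorname{dom} t$ for the domain of $t$ and $\operatorname{ran} t$ for its range. Let $0$ be an extra element not in $\Lambda$ (distinct from the empty function $\varnothing\in\Lambda$), with $0\prec t$ for all $t\in\Lambda$. For $t\in\Lambda$ and $r\in\Lambda\cup\{0\}$ let $(r,t]=\{s\in\Lambda : r\prec s\preccurlyeq t\}$. The sequences $\tau(s,t)$: for $s,t\in\Lambda$ with $s\prec t$, define ordinals $\operatorname{dom} t=\beta_0>\beta_1>\dots>\beta_k=\operatorname{dom} s$ as follows: given $\beta_i>\operatorname{dom} s$, let $\beta_{i+1}\in[\operatorname{dom} s,\beta_i)$ be the unique ordinal such that $t(\beta_{i+1})\le t(\xi)$ for all $\xi\in[\operatorname{dom} s,\beta_i)$; the process stops at a finite stage $k>0$ with $\beta_k=\operatorname{dom} s$. Put $\tau(s,t)=(\beta_k,\dots,\beta_1)$, and let $\tau(t,t)$ be the empty sequence. Let $\ell(s,t)$ be the length of $\tau(s,t)$. For $(t,i)\in D=\Lambda\times\{1,-1\}$ and $r\in\Lambda\cup\{0\}$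 with $r\prec t$, let $$W(r,t,i)=\{(s,j)\in D : s\in(r,t]\text{ and } j=(-1)^{\ell(s,t)}i\}.$$ *)

(* Defs.v *)
From HB Require Import structures.
From mathcomp Require Import all_boot all_order all_algebra.
From mathcomp Require Import boolp classical_sets functions cardinality.
From mathcomp Require Import wochoice topology.

Set Implicit Arguments.
Unset Strict Implicit.
Unset Printing Implicit Defensive.

Import Order.TTheory GRing.Theory Num.Theory.

Local Open Scope classical_set_scope.
Local Open Scope order_scope.

(** The countable ordinals are represented by the well-ordered set [omega1] of
    order type omega_1: in a well-ordering of the uncountable set [set nat], it
    consists of the elements with only countably many predecessors.  The lemmas
    [omega1_well_founded], [omega1_countable_segment] and [omega1_uncountable]
    characterize it up to a unique order isomorphism.  An element [a] stands for
    the order type of its set of predecessors, so every ordinal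
    alpha < omega_1 is identified with [set x | x < a] for a unique [a]. *)

Definition wo_set_nat : rel (set nat) :=
  sval (well_ordering_principle (set nat)).

Lemma wo_set_natP (A : set (set nat)) : A !=set0 ->
  exists2 m, A m & forall x, A x -> wo_set_nat m x.
Proof.
move=> [a Aa].
have [|m [[/asboolP Am mP] _]] := svalP (well_ordering_principle (set nat))
  [pred x | `[< A x >]].
  by exists a; apply/asboolP.
by exists m => // x Ax; apply: mP; apply/asboolP.
Qed.

Lemma wo_set_nat_total : total wo_set_nat.
Proof.
move=> x y; have [|m xym mP] := @wo_set_natP [set x; y]; first by exists x; left.
case: xym mP => -> mP; apply/orP.
  by left; apply: mP; right.
by right; apply: mP; left.
Qed.

Lemma wo_set_nat_anti : antisymmetric wo_set_nat.
Proof.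
move=> x y /andP[xy yx].
have refl z : wo_set_nat z z by have := wo_set_nat_total z z; rewrite orbb.
have [|m [_ mu]] := svalP (well_ordering_principle (set nat))
  [pred z | (z == x) || (z == y)].
  by exists x; rewrite inE eqxx.
have mE z : (z == x) || (z == y) -> m = z.
  by move=> zxy; apply: mu; split=> // w /orP[]/eqP->;
    case/orP: zxy => /eqP ->; rewrite ?refl.
by rewrite -(mE x) ?eqxx // -(mE y) ?eqxx ?orbT.
Qed.

Lemma wo_set_nat_trans : transitive wo_set_nat.
Proof.
move=> y x z xy yz.
have [|m] := @wo_set_natP [set x; y; z]; first by exists x; left; left.
have Px : [set x; y; z] x by left; left.
have Py : [set x; y; z] y by left; right.
have Pz : [set x; y; z] z by right.
move=> [[]|] -> mP; first exact: mP.
  by rewrite (@wo_set_nat_anti x y) // xy mP.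
by rewrite -(@wo_set_nat_anti y z) // yz mP.
Qed.

Definition omega1 : Type :=
  {x : set nat | `[< countable [set y | wo_set_nat y x] >]}.

HB.instance Definition _ := Choice.on omega1.

Definition omega1_le (x y : omega1) : bool := wo_set_nat (val x) (val y).

Lemma omega1_le_anti : antisymmetric omega1_le.
Proof. by move=> x y /wo_set_nat_anti/val_inj. Qed.

Lemma omega1_le_trans : transitive omega1_le.
Proof. by move=> y x z; exact: wo_set_nat_trans. Qed.

Lemma omega1_le_total : total omega1_le.
Proof. by move=> x y; exact: wo_set_nat_total. Qed.

Fact omega1_display : Order.disp_t. Proof. exact: Order.Disp tt tt. Qed.

HB.instance Definition _ := @Order.isOrder.Build omega1_display omega1
  omega1_le _ _ _ (fun _ _ => erefl) (fun _ _ => erefl) (fun _ _ => erefl)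
  omega1_le_anti omega1_le_trans omega1_le_total.

Lemma omega1_well_founded (A : set omega1) : A !=set0 ->
  exists2 m, A m & forall x, A x -> m <= x.
Proof.
move=> [a Aa]; have [|_ [m Am <-] mP] := @wo_set_natP (val @` A).
  by exists (val a), a.
by exists m => // x Ax; apply: mP; exists x.
Qed.

Lemma omega1_countable_segment (a : omega1) : countable [set x | x < a].
Proof.
have /asboolP/countable_injP[f finj] := valP a.
apply/countable_injP; exists (f \o val) => x y; rewrite !inE => xa ya fxy.
have le_a z : z < a -> val z \in [set y | wo_set_nat y (val a)].
  by move=> /ltW za; rewrite inE.
by apply/val_inj/finj; first exact: le_a; first exact: le_a.
Qed.

Lemma omega1_uncountable : ~ countable [set: omega1].
Proof.
move=> /countable_injP[f finj].
have [[x xP]|noV] := pselect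
    (exists x, ~ `[< countable [set y | wo_set_nat y x] >]).
  have [m mP mmin] := @wo_set_natP
    [set x | ~ `[< countable [set y | wo_set_nat y x] >]] (ex_intro _ x xP).
  have below y : wo_set_nat y m -> y <> m ->
      `[< countable [set z | wo_set_nat z y] >].
    move=> ym yNm; apply: contrapT => yP; apply: yNm.
    by apply: wo_set_nat_anti; rewrite ym mmin.
  pose g y := if pselect (`[< countable [set z | wo_set_nat z y] >]) is left p
    then (f (exist _ y p)).+1 else 0%N.
  apply: mP; apply/asboolP/countable_injP; exists g => y z.
  rewrite !inE /= => /below ym /below zm; rewrite /g.
  case: pselect => [py|npy]; case: pselect => [pz|npz] //.
    by move=> [/finj]; rewrite !inE => /(_ I I) [].
  by move=> _; rewrite (contrapT (npy \o ym)) (contrapT (npz \o zm)).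
have allP x : `[< countable [set y | wo_set_nat y x] >].
  by apply: contrapT => xP; apply: noV; exists x.
pose g x := f (exist _ x (allP x)).
have ginj x y : g x = g y -> x = y.
  by move=> /finj; rewrite !inE => /(_ I I) [].
pose B := [set n | exists2 A : set nat, g A = n & ~ A n].
have [BgB|BgB] := pselect (B (g B)); last by apply: (BgB); exists B.
by have [A /ginj -> ] := BgB.
Qed.

(** A function from the ordinal [dom] to omega is a partial function on
    [omega1], defined exactly at the predecessors of [dom]. *)
Record Lambda := {
  dom : omega1;
  lfun :> omega1 -> option nat;
  lfun_dom : forall x, lfun x <> None <-> x < dom;
  lfun_inj : forall x y n, lfun x = Some n -> lfun y = Some n -> x = y;
  lfun_coinf : infinite_set (~` [set n | exists x, lfun x = Some n]) }.

(** The default value 0 is never used below [dom t]. *)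
Definition lval (t : Lambda) (x : omega1) : nat := odflt 0%N (t x).

Definition preceq (s t : Lambda) : Prop :=
  forall x n, s x = Some n -> t x = Some n.

Definition prec (s t : Lambda) : Prop := preceq s t /\ s <> t.

(** [None] is the extra element 0 below all of Lambda. *)
Definition prec0 (r : option Lambda) (t : Lambda) : Prop :=
  if r is Some r' then prec r' t else True.

Definition Loc (r : option Lambda) (t : Lambda) : set Lambda :=
  [set s | prec0 r s /\ preceq s t].

(** When [b > dom s], this is the unique point of [dom s, b) where [t] is
    minimal on [dom s, b). *)
Definition next_beta (s t : Lambda) (b : omega1) : omega1 :=
  xget (dom s) [set x | dom s <= x < b /\
    forall y, dom s <= y < b -> (lval t x <= lval t y)%N].

Definition beta (s t : Lambda) (i : nat) : omega1 :=
  iter i (next_beta s t) (dom t).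

Definition beta_stop (s t : Lambda) : nat :=
  xget 0%N [set k | beta s t k = dom s /\
    forall i, (i < k)%N -> dom s < beta s t i].

Definition tau (s t : Lambda) : seq omega1 :=
  [seq beta s t i | i <- rev (iota 1 (beta_stop s t))].

Definition ell (s t : Lambda) : nat := size (tau s t).

Definition sign : Type := {i : int | i \in [:: 1%R; (-1)%R]}.

Definition D : Type := (Lambda * sign)%type.

Definition W (r : option Lambda) (t : Lambda) (i : sign) : set D :=
  [set p | Loc r t p.1 /\ val p.2 = ((-1) ^+ ell p.1 t * val i)%R].

Definition W_family : set (set D) :=
  [set U | exists r t i, prec0 r t /\ U = W r t i].

(** [D] carries the topology generated by the sets [W r t i] as a subbase; it is
    the only topology for which these sets can possibly form a basis. *)
HB.instance Definition _ := gen_eqMixin D.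
HB.instance Definition _ := gen_choiceMixin D.
HB.instance Definition _ :=
  @isSubBaseTopological.Build D (set D) W_family id.

Definition scattered (X : topologicalType) : Prop :=
  forall A : set X, A !=set0 -> isolated A !=set0.

(* Main.v *)
Require Import Defs.
From HB Require Import structures.
From mathcomp Require Import all_boot all_order all_algebra.
From mathcomp Require Import boolp classical_sets topology.
From mathcomp Require Import cardinality.

(** The proof rests on one fact: if (s, j) lies in W(r,t,i), there is q below s
    with W(q,s,j) contained in W(r,t,i).  As j is determined by the parity of
    l(s,t), it suffices to find q above or equal to r such that
    l(u,t) = l(s,t) + l(u,s) for every u in (q,s] ([Loc_refine]).  When s is
    not t, the minima met by the descent that computes tau(s,t) increase up to
    the last one, t(dom s).  If all values of t on [dom u, dom s) are larger
    than that, the descent for (u,t) passes through the same ordinals down to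
    dom s, and from there on it is the descent for (u,s) ([ellD]).  Because t
    is injective, only finitely many x < dom s have t(x) <= t(dom s), so one
    can take for q the restriction of s to the largest such x that is above
    dom r, or r if there is none ([prec0_lval_ge]).

    The order below t is the order of domains, so two sets W(q,t,i) and
    W(q',t,i) are nested.  Together with the fact above, this makes the sets
    W(q,s,j) a neighbourhood base at (s,j) ([nbhsE_W]).

    Each W(r,t,i) projects bijectively onto an interval of ordinals, namely
    (dom r, dom t], or [0, dom t] when r is the extra element 0, and it carries
    the topology of that interval, which is compact because the ordinals are
    well-ordered ([compact_W]).  Two points with distinct first coordinates are
    separated by cutting the tree at the lower of the two nodes if they are
    comparable, and at the place where they branch otherwise; (t,1) and (t,-1)
    are separated by the sign ([hausdorff_D]).  A point of minimal domain in a
    subset A of D is isolated in A ([scattered_D]). *)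

Local Open Scope classical_set_scope.

Set Implicit Arguments.
Unset Strict Implicit.
Unset Printing Implicit Defensive.

Import Order.TTheory GRing.Theory Num.Theory.
Local Open Scope order_scope.

(** * Functions in Lambda and their order *)

Lemma omega1_ind (P : omega1 -> Prop) :
  (forall a, (forall b, b < a -> P b) -> P a) -> forall a, P a.
Proof.
move=> step a; apply: contrapT => nPa.
have [m nPm mmin] := @omega1_well_founded [set x | ~ P x] (ex_intro _ a nPa).
apply: nPm; apply: step => b bm; apply: contrapT => /mmin.
by rewrite leNgt bm.
Qed.

Lemma lvalP (t : Lambda) x : x < dom t -> t x = Some (lval t x).
Proof. by move=> /lfun_dom; rewrite /lval; case: (t x). Qed.

Lemma lfun_Some_dom (t : Lambda) x n : t x = Some n -> x < dom t.
Proof. by move=> tx; apply/lfun_dom; rewrite tx. Qed.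

Lemma lval_inj (t : Lambda) x y :
  x < dom t -> y < dom t -> lval t x = lval t y -> x = y.
Proof.
move=> /lvalP tx /lvalP ty e; apply: (lfun_inj tx); rewrite e; exact: ty.
Qed.

Lemma Lambda_ext (s t : Lambda) : (forall x, s x = t x) -> s = t.
Proof.
case: s t => [a f fd fi fc] [b g gd gi gc] /= fg.
have {}fg : f = g by apply/funext.
subst g; have ab : a = b.
  apply/eqP; rewrite eq_le; apply/andP; split; rewrite leNgt; apply/negP.
    by move=> /fd/gd; rewrite ltxx.
  by move=> /gd/fd; rewrite ltxx.
subst b; congr Build_Lambda; exact: Prop_irrelevance.
Qed.

Lemma preceq_trans s t u : preceq s t -> preceq t u -> preceq s u.
Proof. by move=> st tu x n /st/tu. Qed.

Lemma preceq_dom s t : preceq s t -> dom s <= dom t.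
Proof.
move=> st; rewrite leNgt; apply/negP => /lvalP/st/lfun_Some_dom.
by rewrite ltxx.
Qed.

Lemma preceq_lval s t x : preceq s t -> x < dom s -> lval s x = lval t x.
Proof. by move=> st /lvalP/st tx; rewrite [RHS]/lval tx. Qed.

(** The tree property: below a given [t], the order is that of domains. *)
Lemma preceq_chain s u t :
  preceq s t -> preceq u t -> dom s <= dom u -> preceq s u.
Proof.
move=> st ut su x n sx; have xu := lt_le_trans (lfun_Some_dom sx) su.
by rewrite (lvalP xu) (preceq_lval ut xu) /lval (st _ _ sx).
Qed.

Lemma preceq_dom_eq s t : preceq s t -> dom s = dom t -> s = t.
Proof.
move=> st e; have ts : preceq t s by apply: (@preceq_chain _ _ t); rewrite ?e.
apply: Lambda_ext => x; case sx: (s x) => [n|]; first by rewrite (st _ _ sx).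
by case tx: (t x) => [n|//]; rewrite -sx (ts _ _ tx).
Qed.

Lemma precP s t : prec s t <-> preceq s t /\ dom s < dom t.
Proof.
split=> -[st]; last by move=> lt; split=> // e; move: lt; rewrite e ltxx.
move=> ne; split=> //; rewrite lt_neqAle preceq_dom // andbT.
by apply/negP => /eqP /(preceq_dom_eq st).
Qed.

(** On a branch through [r], this turns [prec0 r s] into a condition on [dom s]
    alone; the extra element counts as lying below the ordinal 0. *)
Definition above (r : option Lambda) (a : omega1) : bool :=
  if r is Some q then dom q < a else true.

Lemma above_le r a b : above r a -> a <= b -> above r b.
Proof. by case: r => //= q; exact: lt_le_trans. Qed.

Lemma prec0_above r t : prec0 r t -> above r (dom t).
Proof. by case: r => //= q /precP[]. Qed.

Lemma above_prec0 r s t : prec0 r t -> preceq s t -> above r (dom s) ->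
  prec0 r s.
Proof.
case: r => //= q /precP[qt _] st qs; apply/precP; split=> //.
exact: (preceq_chain qt st (ltW qs)).
Qed.

Section Restriction.
Variables (t : Lambda) (c : omega1).

Let f x := if x < c then t x else None.

Let f_dom x : f x <> None <-> x < Order.min c (dom t).
Proof.
by rewrite /f lt_min; case: (x < c); [exact: lfun_dom|split].
Qed.

Let f_t x n : f x = Some n -> t x = Some n.
Proof. by rewrite /f; case: ifP. Qed.

Let f_inj x y n : f x = Some n -> f y = Some n -> x = y.
Proof. by move=> /f_t tx /f_t; exact: lfun_inj tx. Qed.

Let f_coinf : infinite_set (~` [set n | exists x, f x = Some n]).
Proof.
apply: sub_infinite_set (@lfun_coinf t).
by move=> n nt [x /f_t tx]; apply: nt; exists x.
Qed.

Definition restrict : Lambda := Build_Lambda f_dom f_inj f_coinf.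

Lemma restrict_preceq : preceq restrict t.
Proof. by move=> x n /f_t. Qed.

Lemma dom_restrict : c <= dom t -> dom restrict = c.
Proof. by move=> ct; rewrite /= (min_idPl ct). Qed.
End Restriction.

(** * The length of the descent between two nodes *)

Section Beta.
Variables (s t : Lambda).

Definition argmin_on (b x : omega1) := dom s <= x < b /\
  forall y, dom s <= y < b -> (lval t x <= lval t y)%N.

Lemma argmin_onP b : dom s < b -> argmin_on b (next_beta s t b).
Proof.
move=> sb; apply: xgetPex.
pose V n := `[< exists2 x, dom s <= x < b & lval t x = n >].
have exV : exists n, V n.
  by exists (lval t (dom s)); apply/asboolP; exists (dom s); rewrite ?lexx.
have [n /asboolP[x xb <-] nmin] := ex_minnP exV.
by exists x; split=> // y yb; apply: nmin; apply/asboolP; exists y.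
Qed.

Lemma next_beta_unique b x : b <= dom t -> argmin_on b x ->
  next_beta s t b = x.
Proof.
move=> bt xm; apply: xget_unique => // y [yb ymin]; have [xb xmin] := xm.
have [/andP[_ xb'] /andP[_ yb']] := (xb, yb).
apply: (@lval_inj t); [exact: lt_le_trans bt|exact: lt_le_trans bt|].
by apply/eqP; rewrite eqn_leq ymin // xmin.
Qed.

(** The starting point [b] is arbitrary, unlike in [beta_stop], so that the
    descent can be shown to stop by well-founded induction on [b]. *)
Definition descent_length (b : omega1) (k : nat) :=
  iter k (next_beta s t) b = dom s /\
  forall i, (i < k)%N -> dom s < iter i (next_beta s t) b.

Lemma descent_stops b : dom s <= b -> exists k, descent_length b k.
Proof.
elim/omega1_ind: b => b IH; rewrite le_eqVlt => /orP[/eqP<-|sb].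
  by exists 0%N.
have [/andP[sn nb] _] := argmin_onP sb.
have [k [kE klt]] := IH _ nb sn.
exists k.+1; split; first by rewrite iterSr.
by case=> [//|i ik]; rewrite iterSr; exact: klt.
Qed.

Lemma descent_length_unique b k l :
  descent_length b k -> descent_length b l -> k = l.
Proof.
move=> [kE klt] [lE llt].
case: (ltngtP k l) => // [/llt|/klt]; first by rewrite kE ltxx.
by rewrite lE ltxx.
Qed.

Lemma ellE : ell s t = beta_stop s t.
Proof. by rewrite /ell /tau size_map size_rev size_iota. Qed.

Lemma ell_unique k : descent_length (dom t) k -> ell s t = k.
Proof.
move=> kd; rewrite ellE; apply: xget_unique => // l ld.
exact: descent_length_unique ld kd.
Qed.

Lemma ell_descent : preceq s t -> descent_length (dom t) (ell s t).
Proof.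
by move=> /preceq_dom/descent_stops[k kd]; rewrite (ell_unique kd).
Qed.

End Beta.

Lemma ellxx t : ell t t = 0%N.
Proof. by apply: ell_unique; split. Qed.

(** Under the hypothesis on the values of [t] in [dom u, dom s), a minimum of
    [t] on [dom s, b) is also its minimum on [dom u, b), so the descent from
    [dom t] to [dom u] follows the one to [dom s] until it reaches [dom s].
    Below [dom s] the functions [t] and [s] agree, and what remains is the
    descent from [dom s] to [dom u] for [s]. *)
Lemma ellD u s t : preceq u s -> prec s t ->
  (forall x, dom u <= x < dom s -> (lval t (dom s) < lval t x)%N) ->
  ell u t = (ell s t + ell u s)%N.
Proof.
move=> us /precP[st sltt] big.
have ut := preceq_trans us st.
have us' := preceq_dom us.
have [kE klt] := ell_descent st.
have [lE llt] := ell_descent us.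
set k := ell s t in kE klt *; set l := ell u s in lE llt *.
have le_t i : (i <= k)%N -> iter i (next_beta s t) (dom t) <= dom t.
  elim: i => [//|i IH] ik; have [/andP[_ lt] _] := argmin_onP t (klt i ik).
  exact/ltW/(lt_le_trans lt)/IH/ltnW.
have high i : (i <= k)%N ->
    iter i (next_beta u t) (dom t) = iter i (next_beta s t) (dom t).
  elim: i => [//|i IH] ik /=; rewrite IH ?(ltnW ik) //.
  set b := iter i _ _.
  have sb : dom s < b by exact: klt.
  apply: next_beta_unique; first exact/le_t/ltnW.
  have [/andP[sn nb] nmin] := argmin_onP t sb.
  split=> [|y /andP[uy yb]]; first by rewrite (le_trans us' sn) nb.
  (* Below [dom s], [t] exceeds its value at [dom s], hence its minimum. *)
  have [sy|ys] := leP (dom s) y; first by rewrite nmin // sy yb.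
  apply: leq_trans (nmin (dom s) _) (ltnW (big y _)); first by rewrite lexx.
  by rewrite uy ys.
have le_s i : (i <= l)%N -> iter i (next_beta u s) (dom s) <= dom s.
  elim: i => [//|i IH] il; have [/andP[_ lt] _] := argmin_onP s (llt i il).
  exact/ltW/(lt_le_trans lt)/IH/ltnW.
have low i : (i <= l)%N ->
    iter i (next_beta u t) (dom s) = iter i (next_beta u s) (dom s).
  elim: i => [//|i IH] il /=; rewrite IH ?(ltnW il) //.
  set b := iter i _ _.
  have ub : dom u < b by exact: llt.
  have bs : b <= dom s by exact/le_s/ltnW.
  have agree x : x < b -> lval s x = lval t x.
    by move=> xb; apply: preceq_lval => //; exact: lt_le_trans bs.
  apply: next_beta_unique; first exact/(le_trans bs)/preceq_dom.
  have [/andP[sn nb] nmin] := argmin_onP s ub.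
  split=> [|y /andP[uy yb]]; first by rewrite sn nb.
  by rewrite -!agree // nmin // uy yb.
apply: ell_unique; split.
  by rewrite addnC iterD high // kE low.
move=> i ikl; have [ik|ki] := ltnP i k.
  by rewrite high ?(ltnW ik) //; exact: le_lt_trans us' (klt i ik).
rewrite -(subnK ki) iterD high // kE low.
  by apply: llt; rewrite ltn_subLR.
by rewrite leq_subLR ltnW.
Qed.

(** An injective function takes values below [n] at finitely many points only.
    The induction on [n] removes the value [n] by cutting [s] where it is
    taken. *)
Lemma prec0_lval_ge n s r : prec0 r s -> exists2 q, prec0 q s &
  (forall x, above q x -> above r x) /\
  (forall x, x < dom s -> above q x -> (n <= lval s x)%N).
Proof.
move=> rs; elim: n => [|n [q qs [qr qn]]]; first by exists r.
have [[x [xs qx xn]]|nox] :=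
    pselect (exists x, [/\ x < dom s, above q x & lval s x = n]); last first.
  exists q => //; split=> // x xs qx; rewrite ltn_neqAle qn // andbT.
  by apply/negP => /eqP nx; apply: nox; exists x.
have dx : dom (restrict s x) = x by rewrite dom_restrict // ltW.
exists (Some (restrict s x)).
  by apply/precP; rewrite dx; split=> //; exact: restrict_preceq.
split=> y; rewrite /above dx => xy.
  by apply: qr; exact: above_le qx (ltW xy).
move=> xy'; rewrite ltn_neqAle qn // ?andbT; last exact: above_le qx (ltW xy').
apply/negP => /eqP; rewrite -xn => /lval_inj e.
by move: xy'; rewrite -e ?ltxx.
Qed.

(** If [s] is not [t], cutting [s] above all points where it takes values at
    most [t(dom s)] makes [ellD] available for every node of the remaining
    interval. *)
Lemma Loc_refine r s t : prec0 r t -> Loc r t s -> exists2 q, prec0 q s &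
  Loc q s `<=` Loc r t /\
  forall u, Loc q s u -> ell u t = (ell s t + ell u s)%N.
Proof.
move=> rt [rs st]; have [e|ne] := pselect (s = t).
  by exists r => //; rewrite e; split=> // u _; rewrite ellxx.
have [q qs [qr qn]] := prec0_lval_ge (lval t (dom s)).+1 rs.
exists q => //; split=> u [qu us].
  split; last exact: preceq_trans st.
  exact/(above_prec0 rs us)/qr/prec0_above.
apply: ellD => // x /andP[ux xs].
rewrite -[in X in (_ < X)%N](preceq_lval st) //; apply: qn => //.
exact: above_le (prec0_above qu) ux.
Qed.

(** * The sets W *)

Lemma sign_pow_subproof n (i : sign) :
  ((-1) ^+ n * val i)%R \in [:: 1%R; (-1)%R : int].
Proof.
rewrite -signr_odd; have := valP i; rewrite !inE.
by case: (odd n) => /orP[]/eqP->;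
  rewrite ?expr0 ?expr1 ?mul1r ?mulN1r ?opprK eqxx ?orbT.
Qed.

Definition sign_pow n (i : sign) : sign :=
  exist (fun j : int => j \in [:: 1%R; (-1)%R]) _ (sign_pow_subproof n i).

Lemma W_center r t i : prec0 r t -> W r t i (t, i).
Proof. by move=> rt; split; [split|rewrite ellxx expr0 mul1r]. Qed.

(** With [W_dom_inj], this makes [dom] a bijection from [W r t i] onto an
    interval of ordinals. *)
Lemma W_over r t i c : prec0 r t -> above r c -> c <= dom t ->
  exists2 p, W r t i p & dom p.1 = c.
Proof.
move=> rt rc ct; have dc := dom_restrict ct; have ct' := @restrict_preceq t c.
exists (restrict t c, sign_pow (ell (restrict t c) t) i) => //=.
by split=> //=; split=> //; apply: above_prec0 rt ct' _; rewrite dc.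
Qed.

Lemma W_dom_inj r t i p p' : W r t i p -> W r t i p' -> dom p.1 = dom p'.1 ->
  p = p'.
Proof.
case: p p' => [s j] [s' j'] [/= [_ st] jE] [/= [_ s't] j'E] ss'.
have e : s = s'.
  by apply: (preceq_dom_eq _ ss'); apply: (preceq_chain st s't); rewrite ss'.
by subst s'; congr pair; apply: val_inj; exact: etrans jE (esym j'E).
Qed.

(** The signs compose because the lengths in [Loc_refine] add up. *)
Lemma W_refine r t i p : prec0 r t -> W r t i p ->
  exists2 q, prec0 q p.1 & W q p.1 p.2 `<=` W r t i.
Proof.
move=> rt [/(Loc_refine rt)[q qp [sub qell]] pE]; exists q => //.
move=> u [uL jE]; split; first exact: sub.
by rewrite [LHS]jE pE (qell _ uL) mulrA -exprD addnC.
Qed.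

Lemma Loc_directed q q' s : prec0 q s -> prec0 q' s ->
  exists2 r, prec0 r s & Loc r s `<=` Loc q s `&` Loc q' s.
Proof.
have nested q1 q2 : prec0 q1 s -> (forall x, above q2 x -> above q1 x) ->
    Loc q2 s `<=` Loc q1 s.
  move=> q1s q12 u [q2u us]; split=> //; apply: (above_prec0 q1s us).
  exact/q12/prec0_above.
move=> qs q's.
have [le|le] : (forall x, above q x -> above q' x) \/
    (forall x, above q' x -> above q x).
- case: q q' {qs q's} => [q|] [q'|]; [|by left|by right|by left].
  by case: (leP (dom q) (dom q')) => [le|/ltW le]; [right|left] => x;
    exact: le_lt_trans.
- by exists q => // u qu; split=> //; exact: nested qu.
- by exists q' => // u qu; split=> //; exact: nested qu.
Qed.

(** * The topology of D *)

Lemma open_W r t i : prec0 r t -> open (W r t i).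
Proof.
move=> rt; exists [set W r t i]; last by rewrite bigcup_set1.
by move=> _ ->; apply: finI_from1; exists r, t, i.
Qed.

Lemma W_filter (p : D) :
  Filter (filter_from [set q | prec0 q p.1] (fun q => W q p.1 p.2)).
Proof.
apply: filter_from_filter; first by exists None.
move=> q q' qp q'p; have [r rp rsub] := Loc_directed qp q'p.
by exists r => // u [/rsub[uq uq'] uE].
Qed.

(** An open set is a union of finite intersections of subbasic sets.  A
    subbasic set containing [p] contains some [W q p.1 p.2] by [W_refine], and
    since these sets generate a filter, so does a finite intersection. *)
Lemma nbhsE_W (p : D) :
  nbhs p = filter_from [set q | prec0 q p.1] (fun q => W q p.1 p.2).
Proof.
apply/seteqP; split=> A; last first.
  move=> [q qp qA]; apply: filterS qA _; apply: open_nbhs_nbhs.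
  by split; [exact: open_W|case: p qp => s j; exact: W_center].
rewrite nbhsE => -[_ [[E EI <-] [Y EY Yp]] YA].
have [X XW XY] := EI _ EY; have F := W_filter p.
have {}YA : Y `<=` A by move=> u Yu; apply: YA; exists Y.
apply: filterS YA _.
move: Yp; rewrite -XY => Xp; apply: filter_bigI => U UX.
have [r [t [i [rt UE]]]] := set_mem (XW U UX).
by have := Xp U UX; rewrite UE => /(W_refine rt).
Qed.

Lemma nbhs_W (p : D) q : prec0 q p.1 -> nbhs p (W q p.1 p.2).
Proof. by move=> qp; rewrite nbhsE_W; exists q. Qed.

(** This is the compactness of a closed interval of ordinals, in terms of
    filters: the point over the least [c] such that the part [K c] of domain at
    most [c] belongs to [F] is a cluster point.  Otherwise some set of [F]
    would miss a neighbourhood of this point, so its trace on [K c] would be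
    empty or contained in [K b] for some [b < c]. *)
Lemma compact_W r t i : prec0 r t -> compact (W r t i).
Proof.
move=> rt F FF FW.
pose K c := W r t i `&` [set p | dom p.1 <= c].
have [c FK cmin] : exists2 c, F (K c) & forall b, F (K b) -> c <= b.
  apply: (@omega1_well_founded [set c | F (K c)]); exists (dom t).
  by apply: filterS FW => p Wp; split=> //; exact: preceq_dom Wp.1.2.
have [p0 [Wp0 p0c]] := filter_ex FK.
have rc : above r c by exact: above_le (prec0_above Wp0.1.1) p0c.
have ct : c <= dom t.
  apply: cmin; apply: filterS FW => p Wp; split=> //.
  exact: preceq_dom Wp.1.2.
have [p Wp pc] := W_over i rt rc ct.
exists p; split=> // A B FA; rewrite nbhsE_W => -[q qp qB].
have [q' q'p q'W] := W_refine rt Wp.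
have [q'' q''p q''sub] := Loc_directed qp q'p.
have q''B : W q'' p.1 p.2 `<=` B by move=> u [/q''sub[uq _] uE]; apply: qB.
have q''W : W q'' p.1 p.2 `<=` W r t i.
  by move=> u [/q''sub[_ uq] uE]; apply: q'W.
apply: contrapT => noAB.
(* A point of [W r t i] over the interval covered by [W q'' p.1 p.2] belongs
   to the latter set, because [dom] is injective on [W r t i]. *)
have below u : (A `&` K c) u -> ~ above q'' (dom u.1).
  move=> [Au [Wu /= uc]] qu; apply: noAB; exists u; split=> //; apply: q''B.
  have [u' q''u' uu'] : exists2 u', W q'' p.1 p.2 u' & dom u'.1 = dom u.1.
    by apply: W_over => //; rewrite pc.
  by rewrite -(W_dom_inj (q''W _ q''u') Wu uu').
have FAK : F (A `&` K c) by exact: filterI.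
case: q'' q''p below {q''sub q''B q''W} => [q''|] q''p below; last first.
  by have [u /below] := filter_ex FAK; apply.
have : c <= dom q''.
  apply: cmin; apply: filterS FAK => u Ku; split; first by case: Ku => _ [].
  by rewrite /= leNgt; apply/negP; exact: below Ku.
by rewrite leNgt -pc; have /= -> := prec0_above q''p.
Qed.

(** For two points over the same node, all basic sets around them have opposite
    signs over each common node.  If [s] is a proper initial segment of [t], no
    node is both above [s] and at most [s].  Otherwise [s] and [t] differ at a
    least [x], and no node of domain greater than [x] is below both. *)
Lemma hausdorff_D : hausdorff_space D.
Proof.
suff sep (p p' : D) : p != p' -> dom p.1 <= dom p'.1 ->
    exists q q', [/\ prec0 q p.1, prec0 q' p'.1 &
      forall u, W q p.1 p.2 u -> ~ W q' p'.1 p'.2 u].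
  move=> p p' clpp'; apply: contrapT => /eqP pp'.
  wlog le : p p' clpp' pp' / dom p.1 <= dom p'.1.
    move=> H; have [|/ltW] := leP (dom p.1) (dom p'.1); first exact: H.
    apply: H; last by rewrite eq_sym.
    by move=> A B nA nB; rewrite setIC; apply: clpp'.
  have [q [q' [qp q'p' disj]]] := sep _ _ pp' le.
  have [u [Wu /(disj _ Wu)]] := clpp' _ _ (nbhs_W qp) (nbhs_W q'p'); exact.
case: p p' => [s i] [t j] /= st le.
have [sPt|nst] := pselect (preceq s t).
  have [e|ne] := pselect (s = t).
    subst t; exists None, None; split=> // -[u k] [/= _ ki] [/= _ kj].
    suff ij : i = j by move: st; rewrite ij eqxx.
    have sign_neq0 : ((-1) ^+ ell u s != 0 :> int)%R by rewrite signr_eq0.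
    exact/val_inj/(mulfI sign_neq0)/(etrans (esym ki) kj).
  exists None, (Some s); split=> // -[u k] [/= [_ us] _].
  move=> [/= [/precP[_ su] _] _].
  by move: (preceq_dom us); rewrite leNgt su.
have [x [xs xst] xmin] : exists2 x, x < dom s /\ s x <> t x &
    forall y, y < dom s /\ s y <> t y -> x <= y.
  apply: omega1_well_founded; apply: contrapT => no; apply: nst => x n sx.
  rewrite -sx; apply: contrapT => xst; apply: no; exists x; split.
    exact: lfun_Some_dom sx.
  exact/nesym.
have [dx ds] : dom (restrict s x) = x /\ preceq (restrict s x) s.
  by split; [rewrite dom_restrict // ltW|exact: restrict_preceq].
exists (Some (restrict s x)), (Some (restrict s x)); split.
- by apply/precP; rewrite dx.
- apply/precP; rewrite dx; split; last exact: lt_le_trans le.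
  move=> y n; rewrite /=; case: ifP => // yx sy; rewrite -sy.
  apply: contrapT => yst; have : x <= y.
    by apply: xmin; split; [exact: lt_trans xs|exact/nesym].
  by rewrite leNgt yx.
- move=> -[u k] [/= [/precP[_]]]; rewrite dx => xu us _ [/= [_ ut] _].
  by apply: xst; have /lvalP ux := xu; rewrite (us _ _ ux) (ut _ _ ux).
Qed.

(** [W None t i] consists of [(t, i)] and of points of smaller domain. *)
Lemma scattered_D : scattered D.
Proof.
move=> A [p Ap].
have [m [[t i] Ati <-] mmin] := @omega1_well_founded
  [set dom p.1 | p in A] (ex_intro _ _ (ex_intro2 _ _ p Ap erefl)).
exists (t, i); split; first exact/mem_set.
exists (W None t i); first exact: (@nbhs_W (t, i)).
apply/seteqP; split=> [[s j] [Ws As]|_ ->]; last first.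
  by split=> //; exact: W_center.
apply: (W_dom_inj Ws); first exact: W_center.
apply/eqP; rewrite eq_le preceq_dom; last exact: Ws.1.2.
by apply: mmin; exists (s, j).
Qed.

Theorem proposition2p2 :
  basis W_family /\
  locally_compact [set: D] /\
  scattered D /\
  hausdorff_space D.
Proof.
split; [split|split; [|split]].
- by move=> U [r [t [i [rt ->]]]]; exact: open_W.
- move=> p A; rewrite nbhsE_W => -[q qp qA]; exists (W q p.1 p.2) => //; split.
    by exists q, p.1, p.2.
  by case: p qp {qA} => s j; exact: W_center.
- move=> p _; exists (W None p.1 p.2).
    by apply: filterS (@nbhs_W p None I).
  have cW : compact (W None p.1 p.2) by exact: compact_W.
  by split=> //; exact: compact_closed hausdorff_D cW.
- exact: scattered_D.
- exact: hausdorff_D.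
Qed.
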